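(* In the category of algebraic theories, the theory of racks and the theory of GL-quandles are isomorphic.
   Context: An algebraic theory is a single-sorted finitary (Lawvere) theory: a category $\mathcal{T}$ whose objects are the distinct finite powers $T^0,T^1,T^2,\dots$ of an object $T=T^1$; a morphism of algebraic theories is a functor that preserves finite products and sends $T^n$ to $T^n$. Models are finite-product-preserving functors to sets. A rack is a pair $(X,s)$ of a set $X$ and a map $s:X\to S_X$, $x\mapsto s_x$ ($S_X$ the group of permutations of $X$), such that $s_xs_y=s_{s_x(y)}s_x$ for all $x,y\in X$; it is a quandle if $s_x(x)=x$ for all $x$. A GL-structure on a rack $R=(X,s)$ is a rack automorphism $\mathtt{u}$ of $R$ such that $\mathtt{u}s_x=s_x\mathtt{u}$ for all $x\in X$ (a rack automorphism is a bijection $\varphi$ with $\varphi s_x=s_{\varphi(x)}\varphi$ for all $x$); $(R,\mathtt{u})$ is a GL-quandle if $R$ is a quandle. The theory of racks is the algebraic theory with two binary operations $s_-(-)$ and $s^{-1}_-(-)$ subject to the rack axioms (including that $s_y$ and $s_y^{-1}$ are mutually inverse); the theory of GL-quandles has in addition two unary operations $\mathtt{u}$ and $\mathtt{u}^{-1}$, subject to the quandle axioms and the axioms of a GL-structure (including that $\mathtt{u}$ and $\mathtt{u}^{-1}$ are mutually inverse). *)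

(* Defs.v *)
From HB Require Import structures.
From mathcomp Require Import all_boot generic_quotient boolp.

Set Implicit Arguments.
Unset Strict Implicit.
Unset Printing Implicit Defensive.

Local Open Scope quotient_scope.

(* Composition is written in the order of functions: [comp g f] is g after f. *)
Record category_on (Ob : Type) := CategoryOn {
  Hom : Ob -> Ob -> Type;
  idm : forall a, Hom a a;
  comp : forall a b c, Hom b c -> Hom a b -> Hom a c;
  comp_idl : forall a b (f : Hom a b), comp (idm b) f = f;
  comp_idr : forall a b (f : Hom a b), comp f (idm a) = f;
  comp_assoc : forall a b c d (h : Hom c d) (g : Hom b c) (f : Hom a b),
    comp h (comp g f) = comp (comp h g) f
}.

Record category := Category {
  Obj :> Type;
  cat_str :> category_on Obj
}.

Definition isomorphic (C : category) (X Y : C) : Prop :=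
  exists (f : Hom C X Y) (g : Hom C Y X),
    comp g f = idm C X /\ comp f g = idm C Y.

Definition is_product (Ob : Type) (C : category_on Ob) (k : nat)
    (a : 'I_k -> Ob) (p : Ob) (pr : forall i, Hom C p (a i)) : Prop :=
  forall (x : Ob) (f : forall i, Hom C x (a i)),
    exists! g : Hom C x p, forall i, comp (pr i) g = f i.

(* The object T^n is represented by the natural number n, so that the powers
   T^0, T^1, ... are distinct by construction. *)
Record algebraic_theory := AlgebraicTheory {
  theory_cat :> category_on nat;
  theory_powers : forall n : nat,
    exists pr : 'I_n -> Hom theory_cat n 1, is_product pr
}.

(* A functor sending T^n to T^n is determined by its action on morphisms.
   Preservation of finite products is the usual property of functors: product
   cones go to product cones. *)
Record theory_morphism (T U : algebraic_theory) := TheoryMorphism {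
  fmap :> forall m n, Hom T m n -> Hom U m n;
  fmap_id : forall n, fmap (idm T n) = idm U n;
  fmap_comp : forall a b c (g : Hom T b c) (f : Hom T a b),
    fmap (comp g f) = comp (fmap g) (fmap f);
  fmap_prod : forall k (a : 'I_k -> nat) (p : nat)
    (pr : forall i, Hom T p (a i)),
    is_product pr -> is_product (fun i => fmap (pr i))
}.

Lemma theory_morphism_eq T U (F G : theory_morphism T U) :
  (forall m n (f : Hom T m n), F m n f = G m n f) -> F = G.
Proof.
case: F G => [F Fi Fc Fp] [G Gi Gc Gp] /= FG.
have {}FG : F = G by apply: functional_extensionality_dep => m;
  apply: functional_extensionality_dep => n; apply/funext => f; exact: FG.
case: G / FG Gi Gc Gp => Gi Gc Gp.
by congr TheoryMorphism; exact: Prop_irrelevance.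
Qed.

Definition theory_id (T : algebraic_theory) : theory_morphism T T.
Proof. by exists (fun m n f => f). Defined.

Definition theory_comp (T U V : algebraic_theory)
  (G : theory_morphism U V) (F : theory_morphism T U) : theory_morphism T V.
Proof.
exists (fun m n f => G m n (F m n f)).
- by move=> n; rewrite !fmap_id.
- by move=> a b c g f; rewrite !fmap_comp.
- by move=> k a p pr /(fmap_prod F) /(fmap_prod G).
Defined.

Definition AlgTheories : category.
Proof.
exists algebraic_theory.
exists theory_morphism theory_id theory_comp.
- by move=> T U F; exact: theory_morphism_eq.
- by move=> T U F; exact: theory_morphism_eq.
- by move=> T U V W H G F; exact: theory_morphism_eq.
Defined.

Record signature := Signature {
  op :> Type;
  arity : op -> nat
}.

Inductive term (S : signature) (V : Type) : Type :=
| Var of V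
| App (o : S) of ('I_(arity o) -> term S V).
Arguments Var {S V}.
Arguments App {S V}.

Fixpoint subst (S : signature) (V W : Type) (sigma : V -> term S W)
    (t : term S V) : term S W :=
  match t with
  | Var x => sigma x
  | App o ts => App o (fun i => subst sigma (ts i))
  end.

(* Equations are between terms in countably many variables. *)
Record presentation := Presentation {
  psig :> signature;
  axioms : term psig nat -> term psig nat -> Prop
}.

Inductive provable (P : presentation) (V : Type) :
    term P V -> term P V -> Prop :=
| PAxiom l r (sigma : nat -> term P V) :
    axioms l r -> provable (subst sigma l) (subst sigma r)
| PRefl t : provable t t
| PSym t u : provable t u -> provable u t
| PTrans t u v : provable t u -> provable u v -> provable t v
| PCong (o : P) (ts us : 'I_(arity o) -> term P V) :
    (forall i, provable (ts i) (us i)) -> provable (App o ts) (App o us).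

Lemma subst_Var (S : signature) (V : Type) (t : term S V) : subst Var t = t.
Proof.
by elim: t => //= o ts IH; congr App; apply/funext => i; exact: IH.
Qed.

Lemma subst_subst (S : signature) (U V W : Type) (tau : V -> term S W)
    (sigma : U -> term S V) (t : term S U) :
  subst tau (subst sigma t) = subst (fun x => subst tau (sigma x)) t.
Proof.
by elim: t => //= o ts IH; congr App; apply/funext => i; exact: IH.
Qed.

Lemma provable_subst (P : presentation) (V W : Type)
    (sigma tau : V -> term P W) (t u : term P V) :
  (forall x, provable (sigma x) (tau x)) -> provable t u ->
  provable (subst sigma t) (subst tau u).
Proof.
move=> st tu.
have step (v : term P V) : provable (subst sigma v) (subst tau v).
  by elim: v => [x|o ts IH] /=; [exact: st | exact: PCong].
apply: PTrans (step u); elim: tu => {t u}.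
- by move=> l r rho lr; rewrite !subst_subst; exact: PAxiom.
- by move=> t; exact: PRefl.
- by move=> t u _; exact: PSym.
- by move=> t u v _ tu _; exact: PTrans tu.
- by move=> o ts us _ IH; exact: PCong.
Qed.

HB.instance Definition _ (S : signature) (V : Type) := gen_eqMixin (term S V).
HB.instance Definition _ (S : signature) (V : Type) :=
  gen_choiceMixin (term S V).

Section TermQuotient.
Variables (P : presentation) (V : Type).

Definition provableb (t u : term P V) : bool := `[< provable t u >].

Lemma provableb_refl : reflexive provableb.
Proof. by move=> t; apply/asboolP; exact: PRefl. Qed.

Lemma provableb_sym : symmetric provableb.
Proof. by move=> t u; apply/asboolP/asboolP; exact: PSym. Qed.

Lemma provableb_trans : transitive provableb.
Proof.
by move=> u t v /asboolP tu /asboolP uv; apply/asboolP; exact: PTrans uv.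
Qed.

Canonical provable_equiv :=
  EquivRel provableb provableb_refl provableb_sym provableb_trans.

Definition qterm := {eq_quot provable_equiv}.

Definition qcls (t : term P V) : qterm := \pi_qterm t.

Lemma qclsP (t u : term P V) : qcls t = qcls u <-> provable t u.
Proof.
split=> [/eqmodP/asboolP //|tu].
by apply/eqmodP/asboolP.
Qed.

Lemma reprqK (x : qterm) : qcls (repr x) = x.
Proof. exact: reprK. Qed.

Lemma repr_qcls (t : term P V) : provable (repr (qcls t)) t.
Proof. by apply/qclsP; rewrite reprqK. Qed.
End TermQuotient.

Section PresentedTheory.
Variable P : presentation.

(* A morphism T^m -> T^n is an n-tuple of classes of terms in m variables;
   composition is substitution, computed on representatives. *)
Definition presented_hom (m n : nat) : Type := 'I_n -> qterm P 'I_m.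

Definition presented_id (n : nat) : presented_hom n n :=
  fun i => qcls (Var i).

Definition presented_comp (a b c : nat) (g : presented_hom b c)
    (f : presented_hom a b) : presented_hom a c :=
  fun i => qcls (subst (fun j => repr (f j)) (repr (g i))).

Definition presented_cat : category_on nat.
Proof.
exists presented_hom presented_id presented_comp.
- move=> a b f; apply/funext => i; rewrite -[RHS]reprqK.
  apply/qclsP/(PTrans (u := subst (fun j => repr (f j)) (Var i))).
    by apply: provable_subst (repr_qcls _) => x; exact: PRefl.
  exact: PRefl.
- move=> a b f; apply/funext => i; rewrite -[RHS]reprqK.
  apply/qclsP; rewrite -[X in provable _ X]subst_Var.
  by apply: provable_subst (PRefl _) => x; exact: repr_qcls.
- move=> a b c d h g f; apply/funext => i; apply/qclsP.
  apply: PTrans (PSym (provable_subst (fun x => PRefl _) (repr_qcls _))).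
  rewrite subst_subst; apply: provable_subst (PRefl _) => x.
  exact: repr_qcls.
Defined.

Lemma presented_powers (n : nat) :
  exists pr : 'I_n -> Hom presented_cat n 1, is_product pr.
Proof.
exists (fun i _ => qcls (Var i)) => x f.
have prE (g : presented_hom x n) (i : 'I_n) :
    presented_comp (fun _ : 'I_1 => qcls (Var i)) g = fun=> g i.
  apply/funext => j; rewrite -[RHS]reprqK; apply/qclsP.
  exact: (provable_subst (t := repr (qcls (Var i))) (u := Var i)
            (fun x => PRefl _) (repr_qcls _)).
exists (fun i => f i ord0); split=> [i|g gf].
  by rewrite [LHS]prE; apply/funext => j; rewrite (ord1 j).
by apply/funext => i; rewrite -gf [comp _ _]prE.
Qed.

Definition presented_theory : algebraic_theory :=
  AlgebraicTheory presented_powers.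
End PresentedTheory.

Definition app1 (S : signature) (V : Type) (o : S) (e : 1 = arity o)
    (t : term S V) : term S V :=
  App o (fun i => tnth [tuple t] (cast_ord (esym e) i)).

Definition app2 (S : signature) (V : Type) (o : S) (e : 2 = arity o)
    (t u : term S V) : term S V :=
  App o (fun i => tnth [tuple t; u] (cast_ord (esym e) i)).

(* [s x y] stands for s_x(y) and [s' x y] for s_x^{-1}(y). *)
Inductive rack_axioms (S : signature)
    (s s' : term S nat -> term S nat -> term S nat) :
    term S nat -> term S nat -> Prop :=
| rack_left_inverse (x := Var 0) (y := Var 1) :
    rack_axioms s s' (s' x (s x y)) y
| rack_right_inverse (x := Var 0) (y := Var 1) :
    rack_axioms s s' (s x (s' x y)) y
| rack_self_distr (x := Var 0) (y := Var 1) (z := Var 2) :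
    rack_axioms s s' (s x (s y z)) (s (s x y) (s x z)).

Inductive quandle_axioms (S : signature)
    (s s' : term S nat -> term S nat -> term S nat) :
    term S nat -> term S nat -> Prop :=
| quandle_rack l r : rack_axioms s s' l r -> quandle_axioms s s' l r
| quandle_idem (x := Var 0) : quandle_axioms s s' (s x x) x.

Inductive GL_axioms (S : signature)
    (s : term S nat -> term S nat -> term S nat)
    (u u' : term S nat -> term S nat) :
    term S nat -> term S nat -> Prop :=
| GL_left_inverse (x := Var 0) : GL_axioms s u u' (u' (u x)) x
| GL_right_inverse (x := Var 0) : GL_axioms s u u' (u (u' x)) x
| GL_automorphism (x := Var 0) (y := Var 1) :
    GL_axioms s u u' (u (s x y)) (s (u x) (u y))
| GL_central (x := Var 0) (y := Var 1) :
    GL_axioms s u u' (u (s x y)) (s x (u y)).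

Inductive rack_op := rack_s | rack_sinv.

Definition rack_sig : signature :=
  Signature (fun _ : rack_op => 2).

Definition rack_presentation : presentation :=
  @Presentation rack_sig
    (rack_axioms (app2 (o := rack_s : rack_sig) erefl)
                 (app2 (o := rack_sinv : rack_sig) erefl)).

Definition theory_of_racks : algebraic_theory :=
  presented_theory rack_presentation.

Inductive GLQ_op := GLQ_s | GLQ_sinv | GLQ_u | GLQ_uinv.

Definition GLQ_sig : signature :=
  Signature (fun o => match o with
                      | GLQ_s | GLQ_sinv => 2
                      | GLQ_u | GLQ_uinv => 1
                      end).

Definition GLQ_axioms (l r : term GLQ_sig nat) : Prop :=
  let s := app2 (o := GLQ_s : GLQ_sig) erefl in
  let s' := app2 (o := GLQ_sinv : GLQ_sig) erefl in
  let u := app1 (o := GLQ_u : GLQ_sig) erefl in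
  let u' := app1 (o := GLQ_uinv : GLQ_sig) erefl in
  quandle_axioms s s' l r \/ GL_axioms s u u' l r.

Definition theory_of_GL_quandles : algebraic_theory :=
  presented_theory (@Presentation GLQ_sig GLQ_axioms).

(* Main.v *)
From mathcomp Require Import all_boot generic_quotient boolp.
Require Import Defs.

(** On a rack, [theta x = s_x x] is a central automorphism with inverse
    [x |-> s_x^{-1} x], and [t_x = s_x theta^{-1}] is a quandle structure; thus
    [(t, theta)] is a GL-quandle.  Conversely a GL-quandle [(t, u)] gives the
    rack [s_x = t_x u], for which [s_x x = u (t_x x) = u x].  The two
    constructions are mutually inverse, and both are given by terms, so they
    are mutually inverse interpretations of the presentations. *)

Set Implicit Arguments.
Unset Strict Implicit.
Unset Printing Implicit Defensive.

(** * Isomorphisms of algebraic theories *)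

(* Preservation of arbitrary products need not be checked: it is automatic for
   a functor which is bijective on morphisms. *)
Section FullyFaithful.
Variables (T U : algebraic_theory).
Variable F : forall m n, Hom T m n -> Hom U m n.
Variable G : forall m n, Hom U m n -> Hom T m n.
Hypothesis F_id : forall n, F (idm T n) = idm U n.
Hypothesis F_comp : forall a b c (g : Hom T b c) (f : Hom T a b),
  F (comp g f) = comp (F g) (F f).
Hypothesis FK : forall m n, cancel (@F m n) (@G m n).
Hypothesis GK : forall m n, cancel (@G m n) (@F m n).

Lemma inverse_id n : G (idm U n) = idm T n.
Proof. by rewrite -F_id FK. Qed.

Lemma inverse_comp a b c (g : Hom U b c) (f : Hom U a b) :
  G (comp g f) = comp (G g) (G f).
Proof. by rewrite -[in LHS](GK g) -[in LHS](GK f) -F_comp FK. Qed.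

Lemma fully_faithful_prod k (a : 'I_k -> nat) (p : nat)
    (pr : forall i, Hom T p (a i)) :
  is_product pr -> is_product (fun i => F (pr i)).
Proof.
(* The cone [f] in [U] is pulled back along [G]; the image under [F] of its mediating morphism
   mediates [f]. *)
move=> prP x f; have [g [gf g_uniq]] := prP x (fun i => G (f i)).
exists (F g); split=> [i|h hf]; first by rewrite -F_comp gf GK.
by rewrite -(GK h); congr F; apply: g_uniq => i; rewrite -hf inverse_comp FK.
Qed.
End FullyFaithful.

Lemma isomorphic_theories (T U : algebraic_theory)
    (F : forall m n, Hom T m n -> Hom U m n)
    (G : forall m n, Hom U m n -> Hom T m n) :
  (forall n, F n n (idm T n) = idm U n) ->
  (forall a b c (g : Hom T b c) (f : Hom T a b),
     F a c (comp g f) = comp (F b c g) (F a b f)) ->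
  (forall m n, cancel (F m n) (G m n)) ->
  (forall m n, cancel (G m n) (F m n)) ->
  @isomorphic AlgTheories T U.
Proof.
move=> Fi Fc FK GK; have Gi := inverse_id Fi FK.
have Gc := inverse_comp Fc FK GK.
exists (TheoryMorphism Fi Fc (fully_faithful_prod Fc FK GK)).
exists (TheoryMorphism Gi Gc (fully_faithful_prod Gc GK FK)).
by split; apply: theory_morphism_eq => m n f /=; rewrite ?FK ?GK.
Qed.

(** * Interpretations between presentations *)

Section Translation.
Variables S S' : signature.
Variable I : forall o : S, term S' 'I_(arity o).

(** The variables of [I o] are the argument places of [o], so a derived operation is applied by
    substituting for them. *)
Fixpoint translate (V : Type) (t : term S V) : term S' V :=
  match t with
  | Var x => Var x
  | App o ts => subst (fun i => translate (ts i)) (I o)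
  end.

Lemma translate_subst V W (sigma : V -> term S W) (t : term S V) :
  translate (subst sigma t) = subst (fun x => translate (sigma x)) (translate t).
Proof.
elim: t => //= o ts IH; rewrite subst_subst.
by congr subst; apply/funext => i; exact: IH.
Qed.
End Translation.

Definition interprets (P Q : presentation)
    (I : forall o : P, term Q 'I_(arity o)) : Prop :=
  forall l r : term P nat, axioms l r -> provable (translate I l) (translate I r).

(** Translation commutes with substitution, so an instance of an axiom becomes an instance of the
    translated axiom; congruence becomes substitution into [I o]. *)
Lemma provable_translate (P Q : presentation)
    (I : forall o : P, term Q 'I_(arity o)) :
  interprets I -> forall V (t u : term P V),
  provable t u -> provable (translate I t) (translate I u).
Proof.
move=> IP V t u; elim=> {t u}.
- move=> l r sigma lr; rewrite !translate_subst.
  by apply: provable_subst (IP _ _ lr) => x; exact: PRefl.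
- by move=> t; exact: PRefl.
- by move=> t u _; exact: PSym.
- by move=> t u v _ tu _; exact: PTrans tu.
- by move=> o ts us _ IH /=; apply: provable_subst (PRefl _).
Qed.

(** Only one composite is constrained, and only on the generic term [App o Var]; [translateK]
    extends this to all terms by induction. *)
Definition inverse_interpretation (P Q : presentation)
    (I : forall o : P, term Q 'I_(arity o))
    (J : forall o : Q, term P 'I_(arity o)) : Prop :=
  forall o : P, provable (translate J (I o)) (App o Var).

Lemma translateK (P Q : presentation)
    (I : forall o : P, term Q 'I_(arity o))
    (J : forall o : Q, term P 'I_(arity o)) :
  inverse_interpretation I J ->
  forall V (t : term P V), provable (translate J (translate I t)) t.
Proof.
move=> IJ V; elim=> [x|o ts IH] /=; first exact: PRefl.
rewrite translate_subst.
exact: (provable_subst (tau := ts) (u := App o Var) IH (IJ o)).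
Qed.

Section InducedMap.
Variables (P Q : presentation) (I : forall o : P, term Q 'I_(arity o)).
Hypothesis IP : interprets I.

Definition translate_hom m n (f : Hom (presented_theory P) m n) :
    Hom (presented_theory Q) m n :=
  fun i => qcls (translate I (repr (f i))).

(** Makes [translate_hom] independent of the representatives chosen by [repr]. *)
Lemma qcls_translate V (t : term P V) :
  qcls (translate I (repr (qcls t))) = qcls (translate I t).
Proof. by apply/qclsP/provable_translate => //; exact: repr_qcls. Qed.

Lemma translate_hom_id n :
  translate_hom (idm (presented_theory P) n) = idm (presented_theory Q) n.
Proof. by apply/funext => i; rewrite /translate_hom qcls_translate. Qed.

Lemma translate_hom_comp a b c (g : Hom (presented_theory P) b c)
    (f : Hom (presented_theory P) a b) :
  translate_hom (comp g f) = comp (translate_hom g) (translate_hom f).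
Proof.
apply/funext => i; rewrite /translate_hom qcls_translate translate_subst.
by apply/qclsP/provable_subst => [j|]; apply: PSym; exact: repr_qcls.
Qed.
End InducedMap.

Lemma translate_homK (P Q : presentation)
    (I : forall o : P, term Q 'I_(arity o))
    (J : forall o : Q, term P 'I_(arity o)) :
  interprets J -> inverse_interpretation I J ->
  forall m n, cancel (@translate_hom P Q I m n) (@translate_hom Q P J m n).
Proof.
move=> JP IJ m n f; apply/funext => i.
rewrite /translate_hom qcls_translate // -[RHS]reprqK.
by apply/qclsP; exact: translateK.
Qed.

Lemma isomorphic_presented (P Q : presentation)
    (I : forall o : P, term Q 'I_(arity o))
    (J : forall o : Q, term P 'I_(arity o)) :
  interprets I -> interprets J ->
  inverse_interpretation I J -> inverse_interpretation J I ->
  @isomorphic AlgTheories (presented_theory P) (presented_theory Q).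
Proof.
move=> IP JP IJ JI.
apply: (isomorphic_theories (F := @translate_hom P Q I)
                            (G := @translate_hom Q P J)).
- exact: translate_hom_id.
- exact: translate_hom_comp.
- exact: translate_homK.
- exact: translate_homK.
Qed.

(** * Unary and binary operations on terms and on their classes *)

Section Operations.
Variables (S : signature) (o : S).

Lemma subst_app1 V W (sigma : V -> term S W) (e : 1 = arity o) t :
  subst sigma (app1 e t) = app1 e (subst sigma t).
Proof.
by congr App; apply/funext => i; case: (cast_ord _ i) => -[].
Qed.

Lemma subst_app2 V W (sigma : V -> term S W) (e : 2 = arity o) t u :
  subst sigma (app2 e t u) = app2 e (subst sigma t) (subst sigma u).
Proof.
by congr App; apply/funext => i; case: (cast_ord _ i) => -[|[]].
Qed.

Variable S' : signature.
Variable I : forall o : S, term S' 'I_(arity o).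

Lemma translate_app1 V (e : 1 = arity o) (t : term S V) :
  translate I (app1 e t) = subst (fun=> translate I t) (I o).
Proof.
congr subst; apply/funext => i.
by case: (cast_ord _ i) => -[].
Qed.

(** Testing the value of the index avoids a cast along [e], so the right side computes once [o] and
    [I o] are concrete. *)
Lemma translate_app2 V (e : 2 = arity o) (t u : term S V) :
  translate I (app2 e t u) =
  subst (fun i : 'I_(arity o) =>
           if i == 0 :> nat then translate I t else translate I u) (I o).
Proof.
congr subst; apply/funext => i.
by rewrite -[in RHS](cast_ordKV e i); case: (cast_ord (esym e) i) => -[|[]].
Qed.
End Operations.

Section QuotientOperations.
Variables (P : presentation) (V : Type) (o : P).

Definition qapp1 (e : 1 = arity o) (a : qterm P V) : qterm P V :=
  qcls (app1 e (repr a)).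

Definition qapp2 (e : 2 = arity o) (a b : qterm P V) : qterm P V :=
  qcls (app2 e (repr a) (repr b)).

Lemma qcls_app1 e (t : term P V) : qcls (app1 e t) = qapp1 e (qcls t).
Proof.
apply/qclsP/PCong => i; case: (cast_ord _ i) => -[] //= lti.
by apply: PSym; exact: repr_qcls.
Qed.

Lemma qcls_app2 e (t u : term P V) :
  qcls (app2 e t u) = qapp2 e (qcls t) (qcls u).
Proof.
apply/qclsP/PCong => i; case: (cast_ord _ i) => -[|[]] //= lti;
by apply: PSym; exact: repr_qcls.
Qed.
End QuotientOperations.

(** Lifting a valuation in classes to representatives turns each axiom into an identity valid for
    arbitrary classes. *)
Lemma qcls_axiom (P : presentation) V (l r : term P nat)
    (v : nat -> qterm P V) :
  axioms l r ->
  qcls (subst (fun n => repr (v n)) l) = qcls (subst (fun n => repr (v n)) r).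
Proof. by move=> lr; apply/qclsP; exact: PAxiom. Qed.

(** * Racks and GL-quandles on an arbitrary carrier *)

Record is_rack (X : Type) (s s' : X -> X -> X) : Prop := IsRack {
  rack_sK : forall x y, s' x (s x y) = y;
  rack_s'K : forall x y, s x (s' x y) = y;
  rack_sD : forall x y z, s x (s y z) = s (s x y) (s x z)
}.

Section RackToGLQuandle.
Variables (X : Type) (s s' : X -> X -> X).
Hypothesis R : is_rack s s'.
Let sK := rack_sK R.
Let s'K := rack_s'K R.
Let sD := rack_sD R.

(** The automorphism s_x also preserves the inverse operation. *)
Lemma rack_s_s' x y z : s x (s' y z) = s' (s x y) (s x z).
Proof. by rewrite -[LHS](sK (s x y)) -sD s'K. Qed.

(** With y' = s_x(x), self-distributivity gives s_{y'} = s_x s_x s_x^{-1} = s_x. *)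
Lemma rack_s_theta x y : s (s x x) y = s x y.
Proof. by rewrite -{1}(s'K x y) -sD s'K. Qed.

Lemma rack_s_theta' x y : s (s' x x) y = s x y.
Proof. by rewrite -[LHS](sK x) sD s'K sK. Qed.

Lemma rack_s'_theta x y : s' (s x x) y = s' x y.
Proof. by rewrite -[RHS](sK (s x x)) rack_s_theta s'K. Qed.

Lemma rack_thetaK x : s' (s x x) (s x x) = x.
Proof. by rewrite rack_s'_theta sK. Qed.

Lemma rack_theta'K x : s (s' x x) (s' x x) = x.
Proof. by rewrite rack_s_theta' s'K. Qed.

(** These are t_x = s_x theta^{-1} and its inverse theta s_x^{-1}. *)
Let t x y := s x (s' y y).
Let t' x y := s (s' x y) (s' x y).

Lemma rack_tK x y : t' x (t x y) = y.
Proof. by rewrite /t /t' sK rack_theta'K. Qed.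

Lemma rack_t'K x y : t x (t' x y) = y.
Proof. by rewrite /t /t' rack_thetaK s'K. Qed.

(** theta^{-1} commutes with every s_x and theta^{-1}(y) acts as y does, so both sides equal s_x s_y
    theta^{-2}(z). *)
Lemma rack_tD x y z : t x (t y z) = t (t x y) (t x z).
Proof. by rewrite /t -!rack_s_s' -sD rack_s_theta'. Qed.

(** Since theta commutes with s_x, it cancels the theta^{-1} in t_x. With [rack_t_theta] this yields
    theta t_x = s_x = t_x theta, the centrality of theta. *)
Lemma rack_theta_t x y : s (t x y) (t x y) = s x y.
Proof. by rewrite /t -sD rack_theta'K. Qed.

Lemma rack_t_theta x y : t x (s y y) = s x y.
Proof. by rewrite /t rack_thetaK. Qed.
End RackToGLQuandle.

Record is_GL_quandle (X : Type) (t t' : X -> X -> X) (u u' : X -> X) : Prop :=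
IsGLQuandle {
  GLQ_rack : is_rack t t';
  GLQ_idem : forall x, t x x = x;
  GLQ_uK : forall x, u' (u x) = x;
  GLQ_u'K : forall x, u (u' x) = x;
  GLQ_aut : forall x y, u (t x y) = t (u x) (u y);
  GLQ_central : forall x y, u (t x y) = t x (u y)
}.

Section GLQuandleToRack.
Variables (X : Type) (t t' : X -> X -> X) (u u' : X -> X).
Hypothesis Q : is_GL_quandle t t' u u'.
Let tK := rack_sK (GLQ_rack Q).
Let t'K := rack_s'K (GLQ_rack Q).
Let tD := rack_sD (GLQ_rack Q).

(** t_{u(x)} = u t_x u^{-1} as u is an automorphism, and this is t_x as u is central. *)
Lemma GLQ_t_u x y : t (u x) y = t x y.
Proof. by rewrite -(GLQ_u'K Q y) -(GLQ_aut Q) (GLQ_central Q). Qed.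

Lemma GLQ_idem' x : t' x x = x.
Proof. by rewrite -[X in t' x X](GLQ_idem Q x) tK. Qed.

Let s x y := t x (u y).
Let s' x y := u' (t' x y).

Lemma GLQ_sK x y : s' x (s x y) = y.
Proof. by rewrite /s /s' tK (GLQ_uK Q). Qed.

Lemma GLQ_s'K x y : s x (s' x y) = y.
Proof. by rewrite /s /s' (GLQ_u'K Q) t'K. Qed.

(** u commutes with every t_x and t_{u(x)} = t_x, so the powers of u match on both sides and
    self-distributivity of [t] remains. *)
Lemma GLQ_sD x y z : s x (s y z) = s (s x y) (s x z).
Proof. by rewrite /s -!(GLQ_central Q) GLQ_t_u tD !(GLQ_central Q). Qed.

(** Recovers u as the map theta of the rack built from it, which makes the two constructions
    inverse. *)
Lemma GLQ_theta x : s x x = u x.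
Proof. by rewrite /s -(GLQ_central Q) (GLQ_idem Q). Qed.
End GLQuandleToRack.

(** * Term classes as models *)

Notation GLQ_presentation := (@Presentation GLQ_sig GLQ_axioms).

Section QuotientModels.
Variable V : Type.

(** A valuation of the variables 0, 1, 2 by a, b, c; the default [c] of [nth] serves variable 2 and
    all later ones. *)
Let triple T (a b c : T) (n : nat) : T := nth c [:: a; b] n.

Definition qrack_s : qterm rack_presentation V -> _ -> _ :=
  qapp2 (o := rack_s : rack_presentation) erefl.
Definition qrack_sinv : qterm rack_presentation V -> _ -> _ :=
  qapp2 (o := rack_sinv : rack_presentation) erefl.

(** This is the free rack on [V]: provability of an equation becomes equality of classes, to which
    the rack identities above apply. *)
Lemma qrackP : is_rack qrack_s qrack_sinv.
Proof.
split=> [x y|x y|x y z].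
- have := qcls_axiom (triple x y y) (rack_left_inverse _ _).
  by rewrite !subst_app2 !(@qcls_app2 rack_presentation) /= !reprqK.
- have := qcls_axiom (triple x y y) (rack_right_inverse _ _).
  by rewrite !subst_app2 !(@qcls_app2 rack_presentation) /= !reprqK.
- have := qcls_axiom (triple x y z) (rack_self_distr _ _).
  by rewrite !subst_app2 !(@qcls_app2 rack_presentation) /= !reprqK.
Qed.

Definition qGLQ_s : qterm GLQ_presentation V -> _ -> _ :=
  qapp2 (o := GLQ_s : GLQ_presentation) erefl.
Definition qGLQ_sinv : qterm GLQ_presentation V -> _ -> _ :=
  qapp2 (o := GLQ_sinv : GLQ_presentation) erefl.
Definition qGLQ_u : qterm GLQ_presentation V -> _ :=
  qapp1 (o := GLQ_u : GLQ_presentation) erefl.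
Definition qGLQ_uinv : qterm GLQ_presentation V -> _ :=
  qapp1 (o := GLQ_uinv : GLQ_presentation) erefl.

Lemma qGLQP : is_GL_quandle qGLQ_s qGLQ_sinv qGLQ_u qGLQ_uinv.
Proof.
have ax (x y z : qterm GLQ_presentation V) l r (lr : GLQ_axioms l r) :=
  qcls_axiom (P := GLQ_presentation) (triple x y z) lr.
have simp := (subst_app1, subst_app2, @qcls_app1 GLQ_presentation,
              @qcls_app2 GLQ_presentation).
split; first split.
- move=> x y; have := ax x y y _ _
    (or_introl (quandle_rack (rack_left_inverse _ _))).
  by rewrite !simp /= !reprqK.
- move=> x y; have := ax x y y _ _
    (or_introl (quandle_rack (rack_right_inverse _ _))).
  by rewrite !simp /= !reprqK.
- move=> x y z; have := ax x y z _ _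
    (or_introl (quandle_rack (rack_self_distr _ _))).
  by rewrite !simp /= !reprqK.
- move=> x; have := ax x x x _ _ (or_introl (quandle_idem _ _)).
  by rewrite !simp /= !reprqK.
- move=> x; have := ax x x x _ _ (or_intror (GL_left_inverse _ _ _)).
  by rewrite !simp /= !reprqK.
- move=> x; have := ax x x x _ _ (or_intror (GL_right_inverse _ _ _)).
  by rewrite !simp /= !reprqK.
- move=> x y; have := ax x y y _ _ (or_intror (GL_automorphism _ _ _)).
  by rewrite !simp /= !reprqK.
- move=> x y; have := ax x y y _ _ (or_intror (GL_central _ _ _)).
  by rewrite !simp /= !reprqK.
Qed.
End QuotientModels.

(** * The two interpretations and their composites *)

Definition rack_in_GLQ (o : rack_presentation) :
    term GLQ_presentation 'I_(arity o) :=
  let x := Var (ord0 : 'I_2) in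
  let y := Var (ord_max : 'I_2) in
  match o with
  | rack_s =>
      app2 (o := GLQ_s : GLQ_sig) erefl x (app1 (o := GLQ_u : GLQ_sig) erefl y)
  | rack_sinv =>
      app1 (o := GLQ_uinv : GLQ_sig) erefl
        (app2 (o := GLQ_sinv : GLQ_sig) erefl x y)
  end.

(** [s] and [s'] take the variable type as an argument because binary operations need two variables
    and unary ones only one. *)
Definition GLQ_in_rack (o : GLQ_presentation) :
    term rack_presentation 'I_(arity o) :=
  let s V := app2 (V := V) (o := rack_s : rack_sig) erefl in
  let s' V := app2 (V := V) (o := rack_sinv : rack_sig) erefl in
  let x := Var (ord0 : 'I_2) in
  let y := Var (ord_max : 'I_2) in
  let z := Var (ord0 : 'I_1) in
  match o as o0 return term rack_sig 'I_(@arity GLQ_sig o0) with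
  | GLQ_s => s _ x (s' _ y y)
  | GLQ_sinv => s _ (s' _ x y) (s' _ x y)
  | GLQ_u => s _ z z
  | GLQ_uinv => s' _ z z
  end.

(** Puts the generic application into the form to which the rules for classes of [app1] apply. *)
Lemma App_Var1 (S : signature) (o : S) (e : 1 = arity o) :
  App o Var = app1 e (Var (cast_ord e ord0)).
Proof.
congr App; apply/funext => i; rewrite -[i in LHS](cast_ordKV e i).
by rewrite (ord1 (cast_ord _ i)) (tnth_nth (Var i)).
Qed.

Lemma App_Var2 (S : signature) (o : S) (e : 2 = arity o) :
  App o Var = app2 e (Var (cast_ord e ord0)) (Var (cast_ord e ord_max)).
Proof.
congr App; apply/funext => i; rewrite -[i in LHS](cast_ordKV e i).
rewrite (tnth_nth (Var i)).
by case: (cast_ord _ i) => -[|[]] //= lti;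
  congr (Var (cast_ord e _)); apply: val_inj.
Qed.

Section QuotientTranslations.
Variable V : Type.

(** This rule and its companions evaluate translated terms by the operations of the models of term
    classes. *)
Lemma qcls_rack_in_GLQ_s (a b : term rack_presentation V) :
  qcls (P := GLQ_presentation)
    (translate rack_in_GLQ (app2 (o := rack_s : rack_sig) erefl a b)) =
  qGLQ_s (qcls (translate rack_in_GLQ a))
         (qGLQ_u (qcls (translate rack_in_GLQ b))).
Proof.
rewrite translate_app2 subst_app2 subst_app1.
by rewrite (@qcls_app2 GLQ_presentation) (@qcls_app1 GLQ_presentation).
Qed.

Lemma qcls_rack_in_GLQ_sinv (a b : term rack_presentation V) :
  qcls (P := GLQ_presentation)
    (translate rack_in_GLQ (app2 (o := rack_sinv : rack_sig) erefl a b)) =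
  qGLQ_uinv (qGLQ_sinv (qcls (translate rack_in_GLQ a))
                       (qcls (translate rack_in_GLQ b))).
Proof.
rewrite translate_app2 subst_app1 subst_app2.
by rewrite (@qcls_app1 GLQ_presentation) (@qcls_app2 GLQ_presentation).
Qed.

Lemma qcls_GLQ_in_rack_s (a b : term GLQ_presentation V) :
  qcls (P := rack_presentation)
    (translate GLQ_in_rack (app2 (o := GLQ_s : GLQ_sig) erefl a b)) =
  qrack_s (qcls (translate GLQ_in_rack a))
    (qrack_sinv (qcls (translate GLQ_in_rack b))
                (qcls (translate GLQ_in_rack b))).
Proof. by rewrite translate_app2 !subst_app2 !(@qcls_app2 rack_presentation). Qed.

Lemma qcls_GLQ_in_rack_sinv (a b : term GLQ_presentation V) :
  let w := qrack_sinv (qcls (translate GLQ_in_rack a))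
                      (qcls (translate GLQ_in_rack b)) in
  qcls (P := rack_presentation)
    (translate GLQ_in_rack (app2 (o := GLQ_sinv : GLQ_sig) erefl a b)) =
  qrack_s w w.
Proof. by rewrite translate_app2 !subst_app2 !(@qcls_app2 rack_presentation). Qed.

Lemma qcls_GLQ_in_rack_u (a : term GLQ_presentation V) :
  qcls (P := rack_presentation)
    (translate GLQ_in_rack (app1 (o := GLQ_u : GLQ_sig) erefl a)) =
  qrack_s (qcls (translate GLQ_in_rack a)) (qcls (translate GLQ_in_rack a)).
Proof. by rewrite translate_app1 subst_app2 (@qcls_app2 rack_presentation). Qed.

Lemma qcls_GLQ_in_rack_uinv (a : term GLQ_presentation V) :
  qcls (P := rack_presentation)
    (translate GLQ_in_rack (app1 (o := GLQ_uinv : GLQ_sig) erefl a)) =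
  qrack_sinv (qcls (translate GLQ_in_rack a)) (qcls (translate GLQ_in_rack a)).
Proof. by rewrite translate_app1 subst_app2 (@qcls_app2 rack_presentation). Qed.
End QuotientTranslations.

Definition qcls_rack_in_GLQ := (qcls_rack_in_GLQ_s, qcls_rack_in_GLQ_sinv).
Definition qcls_GLQ_in_rack :=
  (qcls_GLQ_in_rack_s, qcls_GLQ_in_rack_sinv,
   qcls_GLQ_in_rack_u, qcls_GLQ_in_rack_uinv).

Lemma rack_in_GLQ_interprets : interprets rack_in_GLQ.
Proof.
move=> l r lr; apply/qclsP; case: lr => [x y|x y|x y z].
- by rewrite !qcls_rack_in_GLQ (GLQ_sK (qGLQP _)).
- by rewrite !qcls_rack_in_GLQ (GLQ_s'K (qGLQP _)).
- by rewrite !qcls_rack_in_GLQ (GLQ_sD (qGLQP _)).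
Qed.

Lemma GLQ_in_rack_interprets : interprets GLQ_in_rack.
Proof.
have R := qrackP nat; move=> l r lr; apply/qclsP.
case: lr => [[{}l {}r [x y|x y|x y z]|x]|[x|x|x y|x y]];
  rewrite !qcls_GLQ_in_rack.
- exact: rack_tK.
- exact: rack_t'K.
- exact: rack_tD.
(* Idempotence t_x(x) = x unfolds to s_x(s_x^{-1}(x)) = x. *)
- exact: rack_s'K.
- exact: rack_thetaK.
- exact: rack_theta'K.
(* Both sides reduce to s_x(y), the right one because theta(x) acts as x does. *)
- by rewrite (rack_theta_t R) (rack_t_theta R) (rack_s_theta R).
- by rewrite (rack_theta_t R) (rack_t_theta R).
Qed.

Lemma rack_in_GLQK : inverse_interpretation rack_in_GLQ GLQ_in_rack.
Proof.
have R := qrackP 'I_2.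
case; apply/qclsP.
  rewrite (App_Var2 (o := rack_s : rack_sig) (erefl 2)) !cast_ord_id.
  by rewrite !qcls_GLQ_in_rack (rack_t_theta R) (@qcls_app2 rack_presentation).
rewrite (App_Var2 (o := rack_sinv : rack_sig) (erefl 2)) !cast_ord_id.
(* u^{-1} t_x^{-1} becomes theta^{-1} theta s_x^{-1}. *)
by rewrite !qcls_GLQ_in_rack (rack_thetaK R) (@qcls_app2 rack_presentation).
Qed.

Lemma GLQ_in_rackK : inverse_interpretation GLQ_in_rack rack_in_GLQ.
Proof.
have Q2 := qGLQP 'I_2; have Q1 := qGLQP 'I_1.
case; apply/qclsP.
- rewrite (App_Var2 (o := GLQ_s : GLQ_sig) (erefl 2)) !cast_ord_id.
  rewrite !qcls_rack_in_GLQ (@qcls_app2 GLQ_presentation).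
  (* theta^{-1}(y) is translated to u^{-1}(t_y^{-1}(y)) = u^{-1}(y), which cancels the u in s_x =
     t_x u. *)
  by rewrite (GLQ_idem' Q2) (GLQ_u'K Q2).
- rewrite (App_Var2 (o := GLQ_sinv : GLQ_sig) (erefl 2)) !cast_ord_id.
  rewrite !qcls_rack_in_GLQ (@qcls_app2 GLQ_presentation).
  by rewrite (GLQ_theta Q2) (GLQ_u'K Q2).
- rewrite (App_Var1 (o := GLQ_u : GLQ_sig) (erefl 1)) cast_ord_id.
  by rewrite !qcls_rack_in_GLQ (@qcls_app1 GLQ_presentation) (GLQ_theta Q1).
- rewrite (App_Var1 (o := GLQ_uinv : GLQ_sig) (erefl 1)) cast_ord_id.
  by rewrite !qcls_rack_in_GLQ (@qcls_app1 GLQ_presentation) (GLQ_idem' Q1).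
Qed.

Theorem corollary5p7 :
  @isomorphic AlgTheories theory_of_racks theory_of_GL_quandles.
Proof.
exact: (isomorphic_presented rack_in_GLQ_interprets GLQ_in_rack_interprets
                             rack_in_GLQK GLQ_in_rackK).
Qed.
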